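(* Consider the family of linear systems, indexed by the scalar parameter $\varepsilon\ge 0$, $$\dot X=M(\varepsilon)X,\qquad M(\varepsilon)=\begin{bmatrix}A&B\\ \varepsilon C&D\end{bmatrix},\qquad Y(t;\varepsilon)=H_{\mathrm{aug}}X(t;\varepsilon),$$ where $X=[x^\top,z^\top]^\top$. Assume all matrices ($A$, $B$, $C$, $D$, $H_{\mathrm{aug}}$), coordinates, and initial conditions are fixed except the scalar $\varepsilon$, and that $Y(t;\varepsilon)$ is continuously differentiable. Let $\varepsilon_0\ge 0$. If there exist a measured component $Y_k$ of $Y$ and a time $t_*$ in the observation interval such that $$\frac{\partial Y_k(t_*;\varepsilon)}{\partial\varepsilon}\bigg|_{\varepsilon=\varepsilon_0}\neq 0,$$ then $\varepsilon$ is locally identifiable at $\varepsilon_0$ from the noiseless trajectory $t\mapsto Y(t;\varepsilon)$.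
   Context: The vector $x$ is the (linearized) grid state, $z$ the hidden source state, and $Y$ the vector of grid-side measured outputs. The block $B$ represents source-to-grid influence and $\varepsilon C$ grid-to-source feedback. The output map is $H_{\mathrm{aug}}=[H\;\;JL]$ with fixed matrices $H,J,L$ (so $Y=Hx+JLz$). The admissible domain of the parameter is $\varepsilon\ge 0$; at the boundary point $\varepsilon_0=0$ derivatives in $\varepsilon$ and neighborhoods are understood one-sided, within $[0,\infty)$. ''$\varepsilon$ is locally identifiable at $\varepsilon_0$ from the noiseless trajectory'' means that there is a neighborhood $U$ of $\varepsilon_0$ in the admissible domain $[0,\infty)$ on which the map $\varepsilon\mapsto Y(\cdot;\varepsilon)$ is one-to-one, i.e. distinct $\varepsilon,\varepsilon'\in U$ give distinct output trajectories on the observation interval. *)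

(* Defs.v *)
From HB Require Import structures.
From mathcomp Require Import all_boot all_order all_algebra.
From mathcomp Require Import all_classical all_reals all_analysis.

Set Implicit Arguments.
Unset Strict Implicit.
Unset Printing Implicit Defensive.

Import Order.TTheory GRing.Theory Num.Theory.
Import numFieldNormedType.Exports.

Local Open Scope classical_set_scope.
Local Open Scope ring_scope.

Definition diff_quotient (R : realType) (V : normedModType R) (f : R -> V)
    (x y : R) : V :=
  (y - x)^-1 *: (f y - f x).

(* Derivatives relative to a set S: ordinary ones in the interior of S,
   one-sided ones at a boundary point that belongs to S. As for the library's
   total derivatives, derive_within is meaningful only under
   derivable_within. *)
Definition is_derive_within (R : realType) (V : normedModType R)
    (S : set R) (f : R -> V) (x : R) (l : V) : Prop :=
  diff_quotient f x y @[y --> within S x^'] --> l.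

Definition derivable_within (R : realType) (V : normedModType R)
    (S : set R) (f : R -> V) (x : R) : Prop :=
  cvg (diff_quotient f x y @[y --> within S x^']).

Definition derive_within (R : realType) (V : normedModType R)
    (S : set R) (f : R -> V) (x : R) : V :=
  lim (diff_quotient f x y @[y --> within S x^']).

(* C^1 on the rectangle E `*` I, in both arguments jointly: both partial
   derivatives exist on the rectangle and are continuous there as functions
   of the pair. *)
Definition continuously_differentiable_on (R : realType) (V : normedModType R)
    (E I : set R) (Y : R -> R -> V) : Prop :=
  [/\ forall e t, E e -> I t -> derivable_within E (Y ^~ t) e,
      forall e t, E e -> I t -> derivable_within I (Y e) t,
      {within E `*` I, continuous
        (fun q : R * R => derive_within E (Y ^~ q.2) q.1)} &
      {within E `*` I, continuous
        (fun q : R * R => derive_within I (Y q.1) q.2)}].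

Definition admissible (R : realType) : set R := [set e | 0 <= e].

Definition system_mx (R : realType) (n m : nat)
    (A : 'M[R]_n) (B : 'M[R]_(n, m)) (C : 'M[R]_(m, n)) (D : 'M[R]_m)
    (e : R) : 'M[R]_(n + m) :=
  block_mx A B (e *: C) D.

Definition H_aug (R : realType) (n m p q : nat)
    (H : 'M[R]_(p, n)) (J : 'M[R]_(p, q)) (L : 'M[R]_(q, m)) :
    'M[R]_(p, n + m) :=
  row_mx H (J *m L).

(* The state is only constrained for admissible e and for times in I. *)
Definition solves_family (R : realType) (N : nat) (M : R -> 'M[R]_N)
    (I : set R) (t0 : R) (X0 : 'cV[R]_N) (X : R -> R -> 'cV[R]_N) : Prop :=
  forall e, admissible e ->
    X e t0 = X0 /\
    forall t, I t -> is_derive_within I (X e) t (M e *m X e t).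

(* U is a neighbourhood of e0 relative to the admissible domain; two
   trajectories are equal when they agree at all times of I. *)
Definition locally_identifiable (R : realType) (p : nat) (I : set R)
    (Y : R -> R -> 'cV[R]_p) (e0 : R) : Prop :=
  exists U : set R,
    [/\ U `<=` @admissible R,
        within (@admissible R) (nbhs e0) U &
        forall e e', U e -> U e' ->
          (forall t, I t -> Y e t = Y e' t) -> e = e'].

(* Main.v *)
(* The output component [Y_k(t_*; e)] is a scalar function of [e] whose
   derivative is continuous and nonzero at [e0], hence nonzero on a relative
   neighbourhood of [e0] in [0, +oo[. By Rolle's theorem this component alone
   already separates the parameters of that neighbourhood. *)
Require Import Defs.
From HB Require Import structures.
From mathcomp Require Import all_boot all_order all_algebra.
From mathcomp Require Import all_classical all_reals all_analysis.
Import Order.TTheory GRing.Theory Num.Theory.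
Import numFieldNormedType.Exports.
Local Open Scope classical_set_scope.
Local Open Scope ring_scope.

Lemma is_derive_within_coord (R : realType) (p : nat) (S : set R)
    (f : R -> 'cV[R]_p) (x : R) (l : 'cV[R]_p) (k : 'I_p) :
  is_derive_within S f x l ->
  is_derive_within S (fun e => f e k 0 : R) x (l k 0).
Proof.
move=> fl.
have := cvg_comp _ _ fl (@coord_continuous R p 1 k 0 l).
apply: cvg_trans; apply: near_eq_cvg; apply: nearW => y.
by rewrite /diff_quotient /= !mxE.
Qed.

Lemma cvg_within_dnbhsP (R : realType) (S : set R) (f : R -> R) (x l : R) :
  f y @[y --> within S x^'] --> l <->
  forall e, 0 < e -> \forall y \near x, y != x -> S y -> `|l - f y| < e.
Proof.
split=> [/cvgrPdist_lt h e /h|h]; first by rewrite !near_withinE.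
by apply/cvgrPdist_lt => e /h; rewrite !near_withinE.
Qed.

(** For [y != x], [f y] equals [(y - x) * diff_quotient f x y + f x], whose first term tends to
    [0 * l]. The point [y = x], which the punctured filter omits, is treated separately. *)
Lemma is_derive_within_continuous (R : realType) (S : set R) (f : R -> R)
    (x l : R) :
  is_derive_within S f x l -> f y @[y --> within S (nbhs x)] --> f x.
Proof.
move=> fl.
have sub : within S x^' `=>` within S (nbhs x).
  by move=> P; rewrite /within /=; exact: nbhs_dnbhs.
have idx : (y - x) @[y --> within S x^'] --> (0 : R).
  rewrite -(subrr x); apply: cvgB; last exact: cvg_cst.
  apply: cvg_trans sub _; exact: cvg_within.
have h : ((y - x) * diff_quotient f x y + f x) @[y --> within S x^'] --> f x.
  rewrite -[X in _ --> X]add0r -(mul0r l).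
  by apply: cvgD; [exact: cvgM|exact: cvg_cst].
apply/cvgrPdist_lt => e e0.
move/cvg_within_dnbhsP : h => /(_ _ e0); rewrite near_withinE.
apply: filterS => y h Sy.
have [->|yx] := eqVneq y x; first by rewrite subrr normr0.
have := h yx Sy; rewrite /diff_quotient /=.
by rewrite /GRing.scale /= mulrA divff ?mul1r ?subrK// subr_eq0.
Qed.

(** Near an interior point the constraint [S y] holds automatically, and the translation [y = x + h]
    turns one difference quotient into the other. This gives Rolle's theorem the ordinary
    derivatives it requires. *)
Lemma is_derive_within_interior (R : realType) (S : set R) (f : R -> R)
    (x l : R) :
  nbhs x S -> is_derive_within S f x l -> is_derive x 1 f l.
Proof.
move=> Sx fl.
have q : (fun h => h^-1 *: ((f \o shift x) (h *: 1) - f x)) @ 0^' --> l.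
  apply/cvgrPdist_lt => e e0.
  rewrite near_withinE.
  have {fl} : \forall y \near x, y != x -> `|l - diff_quotient f x y| < e.
    move/cvg_within_dnbhsP : fl => /(_ _ e0).
    by apply: filterS2 Sx => y Sy h /h; exact.
  rewrite (near_shift 0 x); apply: filterS => y /= h y0.
  have -> : y *: 1 = y :> R by rewrite /GRing.scale /= mulr1.
  move: h; rewrite /diff_quotient /= !subr0 addrK; apply.
  by rewrite -subr_eq0 addrK.
apply: DeriveDef; first by apply/cvg_ex; exists l.
exact: cvg_lim q.
Unshelve. all: by end_near. Qed.

(** Everything to the right of [x] is admissible, so the filter is coarser than the proper filter
    [x^'+], even at the boundary point 0. Limits along it are therefore unique. *)
Lemma admissible_dnbhs_proper (R : realType) (x : R) :
  0 <= x -> ProperFilter (within (@admissible R) x^').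
Proof.
move=> x0; apply: Build_ProperFilter_ex => P.
rewrite /dnbhs /within /= => h.
have : \forall y \near x^'+, P y.
  rewrite /at_right near_withinE; apply: (@filterS _ (nbhs x) _ _ _ _ h) => y {}h xy.
  by apply: h; [rewrite gt_eqF|rewrite /admissible /= (le_trans x0)// ltW].
by move/(@filter_ex _ _ (at_right_proper_filter x)).
Qed.

Lemma derive_within_neq0_inj (R : realType) (f df : R -> R) (x : R) :
  (forall e, 0 <= e -> is_derive_within (@admissible R) f e (df e)) ->
  df y @[y --> within (@admissible R) (nbhs x)] --> df x ->
  df x != 0 ->
  exists U : set R,
    [/\ U `<=` @admissible R,
        within (@admissible R) (nbhs x) U &
        forall e e', U e -> U e' -> f e = f e' -> e = e'].
Proof.
move=> fdf dfx dfx0.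
(* With tolerance [|df x|], a zero of [df] in the ball would give [|df x| < |df x|]. *)
have := dfx; move/cvgrPdist_lt => /(_ `|df x|); rewrite normr_gt0 => /(_ dfx0).
rewrite near_withinE => /nbhs_ballP[d /= d0 dP].
exists (@admissible R `&` ball x d); split; first by move=> y [].
  rewrite /within /=; apply: filterS (nbhsx_ballx x d d0) => y xy y0.
  by split.
suff inj e e' : e < e' -> 0 <= e -> ball x d e -> ball x d e' -> f e = f e' ->
    False.
  move=> e e' [Ae xe] [Ae' xe'] fe; apply/eqP; rewrite eq_le !leNgt.
  by apply/andP; split; apply/negP => ee'; [apply: (inj e' e)|apply: (inj e e')].
move=> ee' Ae xe xe' fe.
(* Even when [e = 0], points strictly between [e] and [e'] are interior to the domain, so the
   derivative there is two-sided. *)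
have gt0 c : c \in `]e, e'[ -> 0 < c.
  by rewrite in_itv /= => /andP[ec _]; exact: le_lt_trans ec.
have drv c : c \in `]e, e'[ -> is_derive c 1 f (df c).
  move=> /gt0 c0; apply: (@is_derive_within_interior _ (@admissible R)).
    by near=> y; rewrite /admissible /= ltW//; near: y; exact: lt_nbhsr.
  exact/fdf/ltW.
(* The endpoint [e] may be the boundary point 0; relative continuity is enough, since [[e, e']] lies
   in the domain. *)
have cf : {within `[e, e'], continuous f}.
  apply/subspace_continuousP => y /=; rewrite in_itv /= => /andP[ey _].
  have := @is_derive_within_continuous _ _ _ _ _ (fdf _ (le_trans Ae ey)).
  apply: cvg_trans; apply: cvg_app; apply: within_subset.
  by move=> z; rewrite /= in_itv /= => /andP[ez _]; exact: le_trans ez.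
have derf y : y \in `]e, e'[ -> derivable f y 1 by move/drv => [].
have [c cee' fc] := Rolle ee' derf cf fe.
have dfc : df c = 0.
  by case: (drv _ cee') => _ <-; case: fc.
have : ball x d c.
  move: cee' xe xe'; rewrite in_itv /= /ball /= => /andP[ec ce'].
  rewrite !ltr_distlC => /andP[xe _] /andP[_ xe'].
  by rewrite (lt_trans xe ec) (lt_trans ce' xe').
by move/dP => /(_ (ltW (gt0 _ cee'))); rewrite dfc subr0 ltxx.
Unshelve. all: by end_near. Qed.

Theorem proposition1 (R : realType) (n m p q : nat)
  (A : 'M[R]_n) (B : 'M[R]_(n, m)) (C : 'M[R]_(m, n)) (D : 'M[R]_m)
  (H : 'M[R]_(p, n)) (J : 'M[R]_(p, q)) (L : 'M[R]_(q, m))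
  (I : interval R) (t0 : R) (x0 : 'cV[R]_n) (z0 : 'cV[R]_m)
  (X : R -> R -> 'cV[R]_(n + m)) (Y : R -> R -> 'cV[R]_p) (e0 : R)
  (ht0 : t0 \in I)
  (hX : solves_family (system_mx A B C D) [set` I] t0 (col_mx x0 z0) X)
  (hY : forall e t, Y e t = H_aug H J L *m X e t)
  (hC1 : continuously_differentiable_on (@admissible R) [set` I] Y)
  (he0 : 0 <= e0) :
  (exists (k : 'I_p) (t : R), t \in I /\
     derive_within (@admissible R) (fun e : R => Y e t k 0 : R) e0 <> 0) ->
  locally_identifiable [set` I] Y e0.
Proof.
move=> [k [t [tI dY0]]].
have [dY _ cdY _] := hC1.
(* [df] is a coordinate of the vector derivative, because the continuity in [hC1] concerns that
   vector; [dfE] identifies it at [e0] with the derivative of the coordinate by uniqueness of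
   limits. *)
pose df e : R := derive_within (@admissible R) (Y ^~ t) e k 0.
have fdf e : 0 <= e ->
    is_derive_within (@admissible R) (fun e : R => Y e t k 0 : R) e (df e).
  by move=> Ae; apply: is_derive_within_coord; exact: dY.
have dfE : derive_within (@admissible R) (fun e : R => Y e t k 0 : R) e0 = df e0.
  have proper_e0 := admissible_dnbhs_proper R e0 he0.
  by apply: cvg_lim; [exact: Rhausdorff|exact: fdf].
have cdf : df y @[y --> within (@admissible R) (nbhs e0)] --> df e0.
  apply: (@cvg_comp _ _ _ (fun e => derive_within (@admissible R) (Y ^~ t) e)
      (fun M : 'cV[R]_p => M k 0)); last exact: coord_continuous.
  (* Joint continuity at [(e0, t)] is restricted to the slice [e |-> (e, t)]: a product
     neighbourhood [P1 * P2] of [(e0, t)] has [t] in [P2], so [P1] serves for the slice. *)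
  move/subspace_continuousP : cdY => /(_ (e0, t) (conj he0 tI)) cdY.
  apply: cvg_trans cdY => /=.
  apply: (@cvg_comp _ _ _ (fun e => (e, t))
    (fun q : R * R => derive_within (@admissible R) (Y ^~ q.2) q.1)
    _ (within (@admissible R `*` [set` I]) (nbhs (e0, t)))) => //.
  move=> P; rewrite /within /= => -[[P1 P2] /= [P1n P2n] sub].
  rewrite nbhs_filterE.
  apply: filterS P1n => e P1e Ae; apply: (sub (e, t)) => //=.
  by split => //; exact: nbhs_singleton.
have [U [UA Un Uinj]] := @derive_within_neq0_inj _ _ df e0 fdf cdf
  (introN eqP (fun h => dY0 (etrans dfE h))).
exists U; split => // e e' Ue Ue' YY; apply: Uinj => //.
by rewrite YY.
Qed.
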